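(* Let $Y$ be a real topological-linear space, let $K\subseteq Y$ be a nontrivial, convex cone and let $y^*\in Y^*\setminus\{0\}$, $b\in Y$ and $k\in K\setminus\{0\}$ be given. Suppose that $y^*(k)>0$ (e.g. if $y^*\in K^\#$). Define $H^{\sim}_{y^*,b}:=\{y\in Y\mid y^*(y)\sim y^*(b)\}$ for each $\sim\,\in\{=,<,>\}$. Then: (1°) $H^{>}_{y^*,b}=H^{=}_{y^*,b}+\mathbb P\cdot k$ and $H^{<}_{y^*,b}=H^{=}_{y^*,b}-\mathbb P\cdot k$. (2°) If $y^*\in K^\#$, then $b+K\setminus\{0\}\subseteq H^{=}_{y^*,b}+\mathbb P\cdot k$ and $b-K\setminus\{0\}\subseteq H^{=}_{y^*,b}-\mathbb P\cdot k$. (3°) If $y^*\in K^+$ and $k\in\operatorname{int}K$, then $b+\operatorname{int}K\subseteq H^{=}_{y^*,b}+\mathbb P\cdot k$ and $b-\operatorname{int}K\subseteq H^{=}_{y^*,b}-\mathbb P\cdot k$. (4°) $Y=\bigcup_{\sim\in\{<,=,>\}}H^{\sim}_{y^*,b}=H^{=}_{y^*,b}+\mathbb R\cdot k$.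
   Context: $Y^*$ is the topological dual of $Y$; $\mathbb R_+=[0,\infty)$, $\mathbb P=(0,\infty)$. A set $K\subseteq Y$ is a cone if $0\in K=\mathbb R_+\cdot K$; it is nontrivial if $\{0\}\ne K\ne Y$. $K^+:=\{y^*\in Y^*\mid \forall k\in K:\ y^*(k)\ge 0\}$ and $K^\#:=\{y^*\in Y^*\mid \forall k\in K\setminus\{0\}:\ y^*(k)>0\}$. The notation $b\pm K\setminus\{0\}$ means $b\pm(K\setminus\{0\})$. *)

(* Defs.v *)
From mathcomp Require Import all_boot all_order all_algebra.
From mathcomp Require Import all_classical all_reals all_analysis.

Set Implicit Arguments.
Unset Strict Implicit.
Unset Printing Implicit Defensive.

Import Order.TTheory GRing.Theory Num.Theory.
Import numFieldNormedType.Exports.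

Local Open Scope classical_set_scope.
Local Open Scope ring_scope.

(* Real topological linear spaces are rendered by [topologicalLmodType R]:
   neither local convexity nor the Hausdorff property is required. *)

Section SetArithmetic.
Context {R : realType} {Y : lmodType R}.
Implicit Types (A B : set Y) (S : set R).

Definition minkowski_add A B : set Y := [set a + b | a in A & b in B].
Definition minkowski_sub A B : set Y := [set a - b | a in A & b in B].
Definition minkowski_scale S A : set Y := [set t *: a | t in S & a in A].

End SetArithmetic.

(* A point [b] occurring in such an expression is written [set b]. *)
Notation "A `++` B" := (minkowski_add A B)
  (at level 50, left associativity) : classical_set_scope.
Notation "A `--` B" := (minkowski_sub A B)
  (at level 50, left associativity) : classical_set_scope.
Notation "S `*:` A" := (minkowski_scale S A)
  (at level 40, left associativity) : classical_set_scope.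

Definition nonneg_reals {R : realType} : set R := [set t | 0 <= t].
Definition pos_reals {R : realType} : set R := [set t | 0 < t].

Section Cones.
Context {R : realType} {Y : topologicalLmodType R}.

Definition is_cone (K : set Y) : Prop := K 0 /\ K = nonneg_reals `*:` K.

Definition nontrivial_cone (K : set Y) : Prop :=
  [/\ is_cone K, [set 0] <> K & K <> [set: Y]].

Definition topological_dual : set {linear Y -> R^o} :=
  [set f | continuous (f : Y -> R^o)].

Definition dual_cone (K : set Y) : set {linear Y -> R^o} :=
  [set f | topological_dual f /\ forall k, K k -> 0 <= (f k : R)].

Definition strict_dual_cone (K : set Y) : set {linear Y -> R^o} :=
  [set f | topological_dual f /\ forall k, (K `\ 0) k -> 0 < (f k : R)].

(* The symbols =, <, > are encoded by [Eq], [Lt], [Gt]. *)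
Definition real_rel (c : comparison) (s t : R) : Prop :=
  match c with
  | Eq => s = t
  | Lt => s < t
  | Gt => s > t
  end.

Definition level_set (c : comparison) (f : {linear Y -> R^o}) (b : Y) : set Y :=
  [set y | real_rel c (f y) (f b)].

End Cones.

(* Main.v *)
Require Import Defs.
From mathcomp Require Import all_boot all_order all_algebra.
From mathcomp Require Import all_classical all_reals all_analysis.

Import Order.TTheory GRing.Theory Num.Theory.
Import numFieldNormedType.Exports.

Local Open Scope classical_set_scope.
Local Open Scope ring_scope.

(* Every y decomposes as (y - t *: k) + t *: k, and the first summand lies on the
   hyperplane ystar = ystar b exactly when t = (ystar y - ystar b) / ystar k; so
   the sign of ystar y - ystar b decides all four parts.  For interior points x
   of K, positivity of ystar x follows from x - t *: k \in K for small t > 0. *)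

Section LevelSets.
Context {R : realType} {Y : topologicalLmodType R}.
Variables (f : {linear Y -> R^o}) (b k : Y).
Hypothesis fk_gt0 : 0 < (f k : R).

(** The coefficient of [k] is forced: applying [f] to [a + t *: k] with [f a = f b] recovers [t]
    after division by [f k]. Keeping [S] arbitrary covers both the open rays and the full line. *)
Lemma level_set_add_ray (S : set R) :
  level_set Eq f b `++` S `*:` [set k]
  = [set y | S (((f y : R) - f b) / f k)].
Proof.
have fk0 : (f k : R) != 0 by rewrite gt_eqF.
apply/seteqP; split => [_ [a fa [_ [t St [_ -> <-]] <-]]|y Sy] /=.
  rewrite linearD linearZ /= (fa : f a = f b) addrAC subrr add0r.
  (* Scaling in [R^o] is convertible to the product of [R]; it is restated as a product so that the
     field lemma applies. *)
  by rewrite [X in X / _](_ : _ = t * (f k : R)) // mulfK.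
pose t : R := ((f y : R) - f b) / f k; exists (y - t *: k); last first.
  by exists (t *: k); [exists t => //; exists k|rewrite subrK].
rewrite /level_set /= linearB linearZ /=.
by rewrite [X in _ - X](_ : _ = t * (f k : R)) // divfK // opprB addrC subrK.
Qed.

(** Subtracting [t *: k] is adding [- t *: k], so this is the additive case for the reflection of
    [S] through 0. *)
Lemma level_set_sub_ray (S : set R) :
  level_set Eq f b `--` S `*:` [set k]
  = [set y | S (((f b : R) - f y) / f k)].
Proof.
have -> : level_set Eq f b `--` S `*:` [set k]
    = level_set Eq f b `++` [set t | S (- t)] `*:` [set k].
  apply/seteqP; split=> _ [a fa [_ [t St [_ -> <-]] <-]].
    exists a => //; exists (- t *: k); last by rewrite scaleNr.
    by exists (- t) => /=; [rewrite opprK|exists k].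
  exists a => //; exists (- t *: k); last by rewrite scaleNr opprK.
  by exists (- t) => //; exists k.
rewrite level_set_add_ray; apply/funext => y /=.
by rewrite -mulNr opprB.
Qed.

Lemma level_set_GtE :
  level_set Gt f b = level_set Eq f b `++` pos_reals `*:` [set k].
Proof.
rewrite level_set_add_ray; apply/funext => y.
by rewrite /level_set /pos_reals /= pmulr_lgt0 ?invr_gt0 // subr_gt0.
Qed.

Lemma level_set_LtE :
  level_set Lt f b = level_set Eq f b `--` pos_reals `*:` [set k].
Proof.
rewrite level_set_sub_ray; apply/funext => y.
by rewrite /level_set /pos_reals /= pmulr_lgt0 ?invr_gt0 // subr_gt0.
Qed.

Lemma bigcup_level_set : \bigcup_c level_set c f b = [set: Y].
Proof.
rewrite -subTset => y _.
have [lt|gt|eq] := ltgtP (f y : R) (f b).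
- by exists Lt.
- by exists Gt.
- by exists Eq.
Qed.

(** The set [A] will be [K] without the origin, or the interior of [K]. *)
Lemma add_pos_sub_level_set (A : set Y) : (forall a, A a -> 0 < (f a : R)) ->
  [set b] `++` A `<=` level_set Gt f b.
Proof.
move=> A_gt0 _ [_ -> [a Aa <-]].
by rewrite /level_set /= linearD ltrDl A_gt0.
Qed.

Lemma sub_pos_sub_level_set (A : set Y) : (forall a, A a -> 0 < (f a : R)) ->
  [set b] `--` A `<=` level_set Lt f b.
Proof.
move=> A_gt0 _ [_ -> [a Aa <-]].
by rewrite /level_set /= linearB ltrBlDr ltrDl A_gt0.
Qed.

Lemma interior_pos (K : set Y) : (forall x, K x -> 0 <= (f x : R)) ->
  forall x, (K°) x -> 0 < (f x : R).
Proof.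
move=> K_ge0 x Kx.
(* Continuity of the vector operations turns the neighbourhood [K] of [x] into a ball of parameters
   [t] around 0. *)
have cvgx : (fun t : R^o => x + t *: (- k)) @ (0 : R^o) --> x.
  rewrite -[X in _ --> X]addr0 -[X in _ --> _ + X](scale0r (- k)).
  have cvgZ : (fun t : R^o => t *: (- k)) @ (0 : R^o) --> (0 : R^o) *: (- k).
    apply: (cvg_comp2 cvg_id (cvg_cst (- k)) (scale_continuous (0, - k))).
  exact: (cvg_comp2 (cvg_cst x) cvgZ (add_continuous (x, 0 *: - k))).
have /nbhs_ballP[e /= e0 Ke] := cvgx _ Kx.
(* The value [e / 2] is positive and strictly inside the ball of radius [e]. *)
have : K (x + (e / 2) *: (- k)).
  apply: Ke; rewrite -ball_normE /= sub0r normrN gtr0_norm ?divr_gt0 //.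
  by rewrite ltr_pdivrMr // ltr_pMr // ltr1n.
(* Nonnegativity at this point reads [e / 2 * f k <= f x], and the left side is positive. *)
move=> /K_ge0; rewrite linearD linearZ linearN /=.
rewrite [X in _ + X](_ : _ = - (e / 2 * (f k : R))); last exact: mulrN.
rewrite subr_ge0; apply: lt_le_trans.
by rewrite mulr_gt0 // divr_gt0.
Qed.

End LevelSets.

Theorem proposition11 (R : realType) (Y : topologicalLmodType R) (K : set Y)
    (ystar : {linear Y -> R^o}) (b k : Y)
    (hK : nontrivial_cone K) (hKconvex : convex_set K)
    (hystar : topological_dual ystar)
    (hystar0 : (ystar : Y -> R^o) <> (fun _ : Y => 0))
    (hk : (K `\ 0) k) (hystark : 0 < (ystar k : R)) :
  [/\ (level_set Gt ystar b
         = level_set Eq ystar b `++` pos_reals `*:` [set k])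
      /\ (level_set Lt ystar b
         = level_set Eq ystar b `--` pos_reals `*:` [set k]),
      (strict_dual_cone K ystar ->
         [set b] `++` (K `\ 0)
           `<=` level_set Eq ystar b `++` pos_reals `*:` [set k]
         /\ [set b] `--` (K `\ 0)
           `<=` level_set Eq ystar b `--` pos_reals `*:` [set k]),
      (dual_cone K ystar -> (K°) k ->
         [set b] `++` K°
           `<=` level_set Eq ystar b `++` pos_reals `*:` [set k]
         /\ [set b] `--` K°
           `<=` level_set Eq ystar b `--` pos_reals `*:` [set k])
    & [set: Y] = \bigcup_c level_set c ystar b
      /\ \bigcup_c level_set c ystar b
         = level_set Eq ystar b `++` [set: R] `*:` [set k]].
Proof.
(* Folding the ray sums back into open half-spaces makes the first part trivial and leaves sign
   conditions in the two inclusion parts. *)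
rewrite -level_set_GtE // -level_set_LtE //; split=> //.
- move=> [_ K_gt0]; split.
    exact: add_pos_sub_level_set.
  exact: sub_pos_sub_level_set.
- move=> [_ K_ge0] _; have := interior_pos _ _ hystark _ K_ge0; split.
    exact: add_pos_sub_level_set.
  exact: sub_pos_sub_level_set.
(* With [S] the whole line, the membership condition on [y] is always true. *)
- by rewrite level_set_add_ray // bigcup_level_set.
Qed.
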